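(* For all $n\ge 1$, the polynomials $W^<_n(\mathbf{x},t)$ and $W^>_n(\mathbf{x},t)$ are $e$-positive.
   Context: For $n\ge 1$, $W_n$ is the set of Smirnov words of length $n$: words $w=w_1\cdots w_n$ over the positive integers with $w_i\ne w_{i+1}$ for all $1\le i\le n-1$. Let $\mathbf{x}=x_1,x_2,\dots$ be indeterminates and $x_w:=x_{w_1}\cdots x_{w_n}$. The descent number is $\mathrm{des}(w):=|\{i\in\{1,\dots,n-1\}: w_i>w_{i+1}\}|$. Define $W^<_n(\mathbf{x},t):=\sum_{w\in W_n,\,w_1<w_n} t^{\mathrm{des}(w)}x_w$ and $W^>_n(\mathbf{x},t):=\sum_{w\in W_n,\,w_1>w_n} t^{\mathrm{des}(w)}x_w$. A symmetric function is $e$-positive if its coefficients in the elementary symmetric function basis $(e_\lambda)$ are nonnegative; a polynomial in $t$ is called $e$-positive if all of its coefficients (of powers of $t$) are $e$-positive symmetric functions (in particular they are symmetric). *)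

(* Defs.v *)
From HB Require Import structures.
From mathcomp Require Import all_boot all_order all_algebra.
From mathcomp Require Import finmap boolp classical_sets functions cardinality.
From mathcomp Require Import fsbigop.
From mathcomp Require Import monalg.

Set Implicit Arguments.
Unset Strict Implicit.
Unset Printing Implicit Defensive.

Import Order.TTheory GRing.Theory Num.Theory.

Local Open Scope classical_set_scope.
Local Open Scope ring_scope.

(* The alphabet of positive integers is represented by nat, the letter i
   standing for i + 1; accordingly the indeterminates are x_0, x_1, x_2, ...
   A monomial in the x_i is an element of {cmonom nat}, i.e. a finitely
   supported exponent function with product mmul and unit mone. *)

(* Formal power series in the x_i are given by their coefficient functions.
   Infinitely many variables are genuinely present, and there is no bound on
   degrees. *)
Definition series (R : Type) : Type := {cmonom nat} -> R.

(* x_w = x_{w_1} ... x_{w_n} *)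
Definition xmon (w : seq nat) : {cmonom nat} :=
  \big[mmul/mone]_(i <- w) ucm i.

(* The formal sum of F(w) x_w over the words w of length n satisfying A.
   Its coefficients are finite sums, by finite_words below. *)
Definition word_series (R : nmodType) (n : nat) (A : pred (seq nat))
    (F : seq nat -> R) : series R :=
  fun m => \sum_(w \in [set w : n.-tuple nat | A w /\ xmon w = m]) F w.

Definition series1 (R : pzSemiRingType) : series R := fun m => (m == mone)%:R.

(* Cauchy product; the sum is finite, by finite_factors below. *)
Definition series_mul (R : pzSemiRingType) (f g : series R) : series R :=
  fun m => \sum_(p \in [set p : {cmonom nat} * {cmonom nat}
                          | mmul p.1 p.2 = m]) f p.1 * g p.2.

(* e_k is the sum of x_{i_1} ... x_{i_k} over i_1 < ... < i_k. *)
Definition esym (k : nat) : series int := word_series k (sorted ltn) (fun=> 1).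

Definition esym_part (la : seq nat) : series int :=
  foldr (@series_mul int) (series1 int) [seq esym k | k <- la].

Definition is_partition (la : seq nat) : bool :=
  sorted geq la && (0%N \notin la).

(* The coefficients c are unique, since the e_la form a basis of the ring of
   symmetric functions over the integers; f is then symmetric as a linear
   combination of the e_la. *)
Definition e_positive (f : series int) : Prop :=
  exists c : {fsfun seq nat -> int with 0},
    [/\ forall la, la \in finsupp c -> is_partition la,
        forall la, 0 <= c la
      & forall m, f m = \sum_(la <- finsupp c) c la * esym_part la m].

(* A polynomial in t with power series coefficients is represented as a power
   series with coefficients in {poly int}, whose 'X is t. *)
Definition tcoef (k : nat) (f : series {poly int}) : series int :=
  fun m => (f m)`_k.

Definition te_positive (f : series {poly int}) : Prop :=
  forall k, e_positive (tcoef k f).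

Definition smirnov (w : seq nat) : bool := sorted [rel a b | a != b] w.

(* Positions are counted from 0 here. *)
Definition des (w : seq nat) : nat :=
  #|[pred i : 'I_(size w).-1 | (nth 0 w i > nth 0 w i.+1)%N]|.

Definition Wlt (n : nat) : series {poly int} :=
  word_series n (fun w => smirnov w && (head 0 w < last 0 w)%N)
    (fun w => 'X^(des w)).

Definition Wgt (n : nat) : series {poly int} :=
  word_series n (fun w => smirnov w && (head 0 w > last 0 w)%N)
    (fun w => 'X^(des w)).

Lemma xmonE (w : seq nat) (i : nat) : xmon w i = count_mem i w.
Proof.
rewrite /xmon; elim: w => [|a w IH]; first by rewrite big_nil cm1.
by rewrite big_cons cmM IH cmU.
Qed.

Lemma finite_words (n : nat) (A : pred (seq nat)) (m : {cmonom nat}) :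
  finite_set [set w : n.-tuple nat | A w /\ xmon w = m].
Proof.
pose F (u : {ffun 'I_n -> finsupp m}) : n.-tuple nat := [tuple val (u i) | i < n].
apply: (@sub_finite_set _ _ (F @` setT)); last first.
  by apply: finite_image; exact: finite_finset.
move=> w /= [_ wm].
have wi (i : 'I_n) : tnth w i \in finsupp m.
  by rewrite mem_finsupp -wm xmonE -lt0n -has_count has_pred1 mem_tnth.
exists [ffun i => [` wi i]%fset] => //.
by apply: eq_from_tnth => i; rewrite tnth_mktuple ffunE.
Qed.

Lemma finite_factors (m : {cmonom nat}) :
  finite_set [set p : {cmonom nat} * {cmonom nat} | mmul p.1 p.2 = m].
Proof.
pose b := (\max_(i <- finsupp m) m i)%N.
pose T := {ffun finsupp m -> 'I_b.+1}.
pose G (u : T) : {cmonom nat} :=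
  mkcmonom [fsfun i : finsupp m => (u i : nat) | 0%N].
have inG (p q : {cmonom nat}) : mmul p q = m -> exists u : T, G u = p.
  move=> pqm; have le i : (p i <= m i)%N by rewrite -pqm cmM leq_addr.
  exists [ffun i => inord (p (val i))]; apply/eqP/cmP => i.
  rewrite cmE /= fsfun_ffun; case: insubP => [j|].
    move=> im ji; rewrite /= ffunE.
    move: ji => /= ->; rewrite inordK // ltnS (leq_trans (le i)) //.
    by rewrite /b (big_rem i) //= leq_maxl.
  by rewrite mem_finsupp negbK => /eqP mi; have := le i; rewrite mi leqn0 => /eqP.
apply: (@sub_finite_set _ _ ((fun u : T * T => (G u.1, G u.2)) @` setT)); last first.
  by apply: finite_image; exact: finite_finset.
case=> p q /= pqm; have [u up] := inG _ _ pqm.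
have [|v vq] := inG q p; first by rewrite mulmC.
by exists (u, v); rewrite //= up vq.
Qed.

(* Main.v *)
Require Import Defs.
From mathcomp Require Import all_boot all_algebra ring zify.
From mathcomp Require Import finmap boolp classical_sets cardinality fsbigop monalg.

(* Let E(z) be the generating function of the elementary symmetric functions.
   Grouping the Smirnov words with a fixed last letter by their first letter
   gives a linear system, solved here explicitly over a finite alphabet.
   Summing over first letters smaller than the last one gives
     (E(tz) - t E(z)) W^<(z) = sum_n (1 - t) a_n(t) e_n z^n
   with a_{n+1} = t a_n + [n]_t.  Dividing by 1 - t,
     W^<_n = a_n e_n + sum_{1 <= i < n} t [i-1]_t e_i W^<_{n-i},
   from which e-positivity follows by induction.  Reversing words replaces
   des by n - 1 - des and exchanges W^< and W^>.

   An identity of series is checked on each monomial separately, in the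
   monoid algebra over an alphabet containing all letters of the monomial. *)

Section Proof.
Local Open Scope ring_scope.
Import GRing.Theory Num.Theory.
Set Implicit Arguments.
Unset Strict Implicit.
Unset Printing Implicit Defensive.

(** * Solving the linear system over a finite alphabet *)

Section LinearSystem.
Variable R : comNzRingType.
Implicit Types (t : R) (y : nat -> R).

Definition egen y (b c : nat) : {poly R} :=
  \prod_(b <= i < c) (1 + (y i)%:P * 'X).

Definition elem y (N k : nat) : R :=
  (egen y 0 N)`_k.

(* The words have length n.+1, first letter b and last letter a. *)
Fixpoint path_gf t y (N a n b : nat) : R :=
  if n is n'.+1 then
    y b * (t * (\sum_(0 <= c < b) path_gf t y N a n' c)
           + \sum_(b.+1 <= c < N) path_gf t y N a n' c)
  else (a == b)%:R * y b.

Lemma egen_recr y b c : (b <= c)%N ->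
  egen y b c.+1 = egen y b c * (1 + (y c)%:P * 'X).
Proof. by move=> bc; rewrite /egen big_nat_recr. Qed.

Lemma egen_recl y b c : (b < c)%N ->
  egen y b c = (1 + (y b)%:P * 'X) * egen y b.+1 c.
Proof. by move=> bc; rewrite /egen big_ltn. Qed.

Lemma egen_cat y a b c :
  (a <= b)%N -> (b <= c)%N -> egen y a c = egen y a b * egen y b c.
Proof. by move=> ab bc; rewrite /egen (big_cat_nat _ (n := b)). Qed.

Lemma egen_nil y a : egen y a a = 1.
Proof. by rewrite /egen big_geq. Qed.

Lemma elem0 y N : elem y N 0 = 1.
Proof.
rewrite /elem; elim: N => [|N IH]; first by rewrite egen_nil coef1.
by rewrite egen_recr // mulrDr mulr1 mulrA coefD coefMX addr0.
Qed.

Lemma elemS y N k :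
  elem y N.+1 k.+1 = elem y N k.+1 + y N * elem y N k.
Proof.
by rewrite /elem egen_recr // mulrDr mulr1 mulrA coefD coefMX coefMC mulrC.
Qed.

Lemma coef_egen_scale t y N k :
  (egen (fun i => t * y i) 0 N)`_k = t ^+ k * elem y N k.
Proof.
rewrite -[LHS]/(elem _ _ _); elim: N k => [|N IH] [|k].
- by rewrite !elem0 mulr1.
- by rewrite /elem !egen_nil !coef1 mulr0.
- by rewrite !elem0 mulr1.
- by rewrite !elemS !IH exprS; ring.
Qed.

Definition denom t y N : {poly R} :=
  egen (fun i => t * y i) 0 N - t%:P * egen y 0 N.

Lemma coef_denom t y N k :
  (denom t y N)`_k = (t ^+ k - t) * elem y N k.
Proof. by rewrite coefB coef_egen_scale coefCM mulrBl. Qed.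

(* With F_c the generating function of the words from c to a, and D such that
   denom = (1 - t) D, this is D ((1 - t) sum_(c >= b) F_c + t sum_c F_c), for
   which the linear system becomes the two-term recurrence tail_num_step. *)
Definition tail_num t y (N a b : nat) : {poly R} :=
  let ty i := t * y i in
  if (b <= a)%N then
    (y a)%:P * 'X * egen ty a.+1 N * egen y b a * egen ty 0 b
  else
    t%:P * (y a)%:P * 'X * egen y b N * egen ty a.+1 b * egen y 0 a.

(** At [b = N] the tail is empty and only t times the total remains; at [b = 0] the two terms add up
    to the total. *)
Lemma tail_num_boundary t y N a : (a < N)%N ->
  tail_num t y N a N = t%:P * tail_num t y N a 0.
Proof. by move=> aN; rewrite /tail_num leqNgt aN /= !egen_nil; ring. Qed.

(** Away from [a], passing from [b] to [b.+1] trades a factor 1 + y_b z for 1 + t y_b z. At [b = a]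
    the products complete to E(tz) and t E(z), whose difference is [denom]. *)
Lemma tail_num_step t y N a b :
  (a < N)%N -> (b < N)%N ->
  tail_num t y N a b * (1 + (t * y b)%:P * 'X) =
  tail_num t y N a b.+1 * (1 + (y b)%:P * 'X)
  + (a == b)%:R * ((y b)%:P * 'X * denom t y N).
Proof.
move=> aN bN; rewrite /tail_num /denom polyCM.
case: (ltngtP a b) => [ab|ba|ab].
- rewrite mul0r addr0.
  by rewrite (egen_recl _ bN) egen_recr // polyCM; ring.
- by rewrite mul0r addr0 (egen_recl _ ba) (egen_recr _ (leq0n b)) polyCM; ring.
- subst b.
  rewrite mul1r !egen_nil.
  rewrite (@egen_cat y 0 a N) ?(ltnW aN) // (egen_recl y aN).
  rewrite (@egen_cat (fun i => t * y i) 0 a N) ?(ltnW aN) //.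
  by rewrite (egen_recl (fun i => t * y i) aN) polyCM; ring.
Qed.

(** The difference of consecutive tails is (1 - t) D F_b, that is, [denom] times F_b. *)
Definition path_num t y (N a b : nat) : {poly R} :=
  tail_num t y N a b - tail_num t y N a b.+1.

Lemma sum_path_num t y N a b c : (b <= c)%N ->
  \sum_(b <= i < c) path_num t y N a i = tail_num t y N a b - tail_num t y N a c.
Proof.
move=> bc; rewrite -opprB -(telescope_sumr _ bc) -sumrN.
by apply: eq_bigr => i _; rewrite opprB.
Qed.

Lemma path_num_rec t y N a b :
  (a < N)%N -> (b < N)%N ->
  path_num t y N a b = (y b)%:P * 'X *
    (t%:P * (\sum_(0 <= c < b) path_num t y N a c)
     + \sum_(b.+1 <= c < N) path_num t y N a c + (a == b)%:R * denom t y N).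
Proof.
move=> aN bN; rewrite !sum_path_num // tail_num_boundary //.
(* After telescoping, the two sides of the goal differ by the same polynomial as those of
   [tail_num_step]. *)
have := tail_num_step t y aN bN; rewrite polyCM => /eqP; rewrite -subr_eq0 => /eqP st.
apply/eqP; rewrite -subr_eq0 -[X in _ == X]st; apply/eqP; rewrite /path_num; ring.
Qed.

(** The product of [denom] and F_b obeys the recurrence [path_num_rec], so it agrees with [path_num]
    degree by degree. The degree is [n.+1] because [path_gf] at [n] counts words of length
    [n.+1]. *)
Lemma denom_path_gf t y N a n b :
  (a < N)%N -> (b < N)%N ->
  \sum_(i < n.+1) (denom t y N)`_i * path_gf t y N a (n - i) b =
  (path_num t y N a b)`_n.+1.
Proof.
move=> aN; elim: n b => [|n IH] b bN.
  rewrite big_ord1 /= path_num_rec // -mulrA coefCM coefXM /=.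
  rewrite 2![in RHS]coefD [in RHS]coefCM ![in RHS]coef_sum.
  have f0 c : (c < N)%N -> (path_num t y N a c)`_0 = 0.
    by move=> cN; rewrite path_num_rec // -mulrA coefCM coefXM mulr0.
  rewrite big_nat_cond big1 ?mulr0 ?add0r; last first.
    by move=> c /andP[/andP[_ cb] _]; rewrite f0 // (ltn_trans cb).
  rewrite big_nat_cond big1 ?add0r; last first.
    by move=> c /andP[/andP[_ cb] _]; rewrite f0.
  by case: (a == b); rewrite ?mul0r ?mul1r ?coef0 ?mulr0 // mulrC.
have swap u v : (v <= N)%N -> \sum_(u <= c < v) (path_num t y N a c)`_n.+1 =
    \sum_(i < n.+1) (denom t y N)`_i * \sum_(u <= c < v) path_gf t y N a (n - i) c.
  move=> vN; under [RHS]eq_bigr => i _ do rewrite mulr_sumr.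
  rewrite exchange_big; apply: eq_big_nat => c /andP[_ cv] /=.
  by rewrite IH // (leq_trans cv).
(* The last summand meets [path_gf] at one-letter words and yields the source term with [a == b]; in
   the others [path_gf] unfolds once. *)
rewrite big_ord_recr /= subnn /= path_num_rec // -mulrA coefCM coefXM /=.
rewrite 2![in RHS]coefD [in RHS]coefCM ![in RHS]coef_sum !swap ?(ltnW bN) //.
rewrite mulrDr mulr_sumr -big_split mulr_sumr /=; congr (_ + _).
  apply: eq_bigr => i _; have lein : (i <= n)%N by rewrite -ltnS.
  rewrite (subSn lein) /=.
  by rewrite mulrCA !mulrDr (mulrCA t).
by case: (a == b); rewrite ?mul0r ?mul1r ?coef0 ?mulr0 // mulrC.
Qed.

(* As in path_gf, the words have length n.+1. *)
Definition asc_gf t y (N n : nat) : R :=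
  \sum_(0 <= a < N) \sum_(0 <= b < a) path_gf t y N a n b.

(** * The recurrence for words with first letter below the last *)

Fixpoint qint (t : R) (n : nat) : R :=
  if n is n'.+1 then 1 + t * qint t n' else 0.

(** This is 1 + 2t + ... + (n-1) t^(n-2), the derivative of [n]_t. *)
Fixpoint asc_coef (t : R) (n : nat) : R :=
  if n is n'.+1 then t * asc_coef t n' + qint t n' else 0.

Lemma qintE (t : R) n : (1 - t) * qint t n = 1 - t ^+ n.
Proof.
elim: n => [|n IH] /=; first by rewrite mulr0 expr0 subrr.
by rewrite mulrDr mulrCA IH exprS; ring.
Qed.

(** The sum of [path_num] over b < a, already telescoped: [denom] times the generating function of
    [asc_gf]. *)
Definition asc_num t y N : {poly R} :=
  \sum_(0 <= a < N) (tail_num t y N a 0 - tail_num t y N a a).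

(** A new largest letter N multiplies the terms with a < N by 1 + t y_N z; the last summand is the
    new term a = N. *)
Lemma asc_numS t y N :
  asc_num t y N.+1 = asc_num t y N * (1 + (t * y N)%:P * 'X)
    + (y N)%:P * 'X * (egen y 0 N - egen (fun i => t * y i) 0 N).
Proof.
rewrite /asc_num big_nat_recr //= mulr_suml; congr (_ + _).
  apply: eq_big_nat => a /andP[_ aN].
  by rewrite /tail_num !leqnn !leq0n !egen_recr //; ring.
by rewrite /tail_num !leqnn !leq0n !egen_nil; ring.
Qed.

Lemma coef0_step (p q : {poly R}) (a b : R) :
  (p * (1 + a%:P * 'X) + b%:P * 'X * q)`_0 = p`_0.
Proof.
by rewrite coefD !coef0M coefD coef1 !coef0M coefX !mulr0 mul0r !addr0 mulr1.
Qed.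

Lemma coefS_step (p q : {poly R}) (a b : R) n :
  (p * (1 + a%:P * 'X) + b%:P * 'X * q)`_n.+1 = p`_n.+1 + a * p`_n + b * q`_n.
Proof.
rewrite mulrDr mulr1 -mulrA coefD coefCM coefXM /= coefD.
by rewrite mulrA coefMX coefMC (mulrC a).
Qed.

Lemma coef_asc_num t y N n :
  (asc_num t y N)`_n = (1 - t) * asc_coef t n * elem y N n.
Proof.
elim: N n => [|N IH] [|n].
- by rewrite /asc_num big_geq // coef0 /= mulr0 mul0r.
- by rewrite /asc_num big_geq // coef0 /elem egen_nil coef1 mulr0.
- by rewrite asc_numS coef0_step IH /= mulr0 !mul0r.
- rewrite asc_numS coefS_step coefB !IH coef_egen_scale elemS -/(elem y N n) /=.
  have -> : elem y N n - t ^+ n * elem y N n = (1 - t) * qint t n * elem y N n.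
    by rewrite qintE; ring.
  by ring.
Qed.

(** In the convolution of [denom] with [asc_gf] the constant coefficient is 1 - t, and every other
    coefficient of [denom] is a multiple of it, as is the right-hand side [asc_num]. Regularity
    cancels this factor. *)
Lemma asc_gf_rec t y N n :
  GRing.lreg (1 - t) ->
  asc_gf t y N n = asc_coef t n.+1 * elem y N n.+1
    + \sum_(i < n) t * qint t i * elem y N i.+1 * asc_gf t y N (n - i.+1).
Proof.
move=> reg; apply: reg.
have key : \sum_(i < n.+1) (denom t y N)`_i * asc_gf t y N (n - i) =
    (1 - t) * asc_coef t n.+1 * elem y N n.+1.
  rewrite -coef_asc_num /asc_num coef_sum.
  under eq_bigr => i _ do rewrite /asc_gf mulr_sumr.
  rewrite exchange_big /=; apply: eq_big_nat => a /andP[_ aN].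
  rewrite -sum_path_num // coef_sum.
  under eq_bigr => i _ do rewrite mulr_sumr.
  rewrite exchange_big /=; apply: eq_big_nat => b /andP[_ ba].
  by rewrite denom_path_gf // (ltn_trans ba).
move: (asc_gf t y N) key => S.
rewrite big_ord_recl coef_denom elem0 expr0 subn0 mulr1 => key.
rewrite mulrDr mulrA -key -addrA mulr_sumr -big_split /= big1 ?addr0 // => i _.
rewrite /bump add1n coef_denom.
have -> : t ^+ i.+1 - t = - (t * ((1 - t) * qint t i)).
  by rewrite qintE exprS; ring.
by ring.
Qed.

End LinearSystem.

(** * Generating functions as sums over words *)

Fixpoint words (N n : nat) : seq (seq nat) :=
  if n is n'.+1 then [seq b :: w | b <- index_iota 0 N, w <- words N n']
  else [:: [::]].

Lemma big_words (V : nmodType) N n (P : pred (seq nat)) (F : seq nat -> V) :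
  \sum_(w <- words N n.+1 | P w) F w =
  \sum_(0 <= b < N) \sum_(w <- words N n | P (b :: w)) F (b :: w).
Proof.
rewrite /= big_mkcond big_allpairs_dep /=.
by apply: eq_bigr => b _; rewrite -big_mkcond.
Qed.

Lemma mem_words N n w : (w \in words N n) = (size w == n) && all (ltn^~ N) w.
Proof.
elim: n w => [|n IH] [|b w] //=; first by apply/allpairsP => -[[]] /= ? ? [].
rewrite eqSS andbCA -IH; apply/allpairsP/andP => /=.
  by case=> -[c v] /= [cN vw [-> ->]]; rewrite mem_index_iota in cN.
by case=> bN ww; exists (b, w); rewrite mem_index_iota.
Qed.

Lemma uniq_words N n : uniq (words N n).
Proof.
elim: n => //= n IH; apply: allpairs_uniq => //; first exact: iota_uniq.
by move=> [? ?] [? ?] _ _ /= [-> ->].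
Qed.

(** A word with monomial [m] uses only letters from the support of [m], so all contributing words
    occur in [words N n]. *)
Lemma word_seriesE (V : nmodType) N n A (F : seq nat -> V) (m : {cmonom nat}) :
  (forall i, i \in finsupp m -> (i < N)%N) ->
  word_series n A F m = \sum_(w <- words N n | A w && (xmon w == m)) F w.
Proof.
move=> mN; rewrite /word_series fsbig_finite; last exact: finite_words.
rewrite -(big_map (@tval n nat) xpredT) -[RHS]big_filter; apply: perm_big.
apply: uniq_perm; first by rewrite (map_inj_uniq val_inj) fset_uniq.
  by rewrite filter_uniq // uniq_words.
move=> w; rewrite mem_filter mem_words.
apply/mapP/idP => [[v + ->]|/andP[/andP[Aw /eqP wm] /andP[/eqP sw wN]]].
  rewrite in_fset_set; last exact: finite_words.
  rewrite inE /= => -[Av vm]; rewrite Av vm eqxx size_tuple eqxx /=.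
  apply/allP => i iv; apply: mN; rewrite -cmE_neq0 -vm xmonE -lt0n.
  by rewrite -has_count has_pred1.
exists (Tuple (introT eqP sw)) => //.
by rewrite in_fset_set ?inE //; exact: finite_words.
Qed.

Lemma des1 b : des [:: b] = 0%N.
Proof. by rewrite /des eq_card0 // => -[]. Qed.

Lemma des_cons2 b c w : des [:: b, c & w] = ((c < b) + des (c :: w))%N.
Proof.
rewrite /des -!sum1_card /= big_mkcond big_ord_recl /=.
rewrite [in RHS]big_mkcond /=; congr (_ + _)%N.
Qed.

Lemma elem_words (R : comNzRingType) (y : nat -> R) N k :
  elem y N k = \sum_(w <- words N k | sorted ltn w) \prod_(i <- w) y i.
Proof.
(* The lower bound [b] lets the induction on [k] remove the smallest letter of an increasing
   word. *)
suff H b : (b <= N)%N -> (egen y b N)`_k =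
    \sum_(w <- words N k | sorted ltn w && all (leq b) w) \prod_(i <- w) y i.
  rewrite /elem H //; apply: eq_bigl => w.
  by rewrite (@eq_all _ _ xpredT) // all_predT andbT.
elim: k b => [|k IH] b bN.
  rewrite /= big_cons !big_nil /= addr0.
  rewrite -horner_coef0 /egen horner_prod big1 // => i _.
  by rewrite !hornerE.
transitivity (\sum_(b <= c < N) y c * (egen y c.+1 N)`_k).
  move: (erefl (N - b)%N); move: {2}(N - b)%N => d; elim: d b bN => [|d IHd] b bN.
    move/eqP; rewrite subn_eq0 => Nb.
    have -> : b = N by apply/eqP; rewrite eqn_leq bN.
    by rewrite egen_nil coef1 big_geq.
  move=> Nb; have bN' : (b < N)%N by rewrite -subn_gt0 Nb.
  rewrite egen_recl // mulrDl mul1r coefD -mulrA coefCM coefXM /= big_ltn //.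
  by rewrite IHd // 1?addrC // subnS Nb.
rewrite big_words [in RHS](@big_cat_nat _ _ _ b) //= [X in _ = X + _]big_nat_cond.
rewrite [X in _ = X + _]big1 ?add0r.
  apply: eq_big_nat => c /andP[bc cN]; rewrite IH // mulr_sumr.
  rewrite (eq_bigl (fun w => sorted ltn w && all (ltn c) w)); last first.
    move=> w; rewrite (path_sortedE ltn_trans) bc /= -andbA andbC -andbA.
    congr (_ && _).
    apply/andP/idP => [[]//|cw]; split=> //.
    by apply: sub_all cw => i /= ci; rewrite (leq_trans bc) // ltnW.
  by apply: eq_bigr => w _; rewrite big_cons.
move=> c /andP[/andP[_ cb] _]; rewrite big_pred0 // => w.
by rewrite /= (leqNgt b) cb /= andbF.
Qed.

Lemma path_gf_words (R : comNzRingType) (t : R) y N a n b : (b < N)%N ->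
  path_gf t y N a n b =
  \sum_(w <- words N n | smirnov (b :: w) && (last b w == a))
    t ^+ des (b :: w) * \prod_(i <- b :: w) y i.
Proof.
elim: n b => [|n IH] b bN.
  rewrite /= big_cons big_nil big_seq1 des1 expr0 mul1r (eq_sym a).
  by case: eqP => _ /=; rewrite ?mul1r ?mul0r ?addr0.
(* The second letter [c] is split at [b]: below it there is a descent, at it the word is not
   Smirnov, above it there is no descent. *)
rewrite big_words /= [in RHS](@big_cat_nat _ _ _ b) ?(ltnW bN) //=.
rewrite [X in _ = _ + X]big_ltn //.
rewrite [X in _ + (X + _)]big_pred0; last by move=> w; rewrite /smirnov /= eqxx.
rewrite add0r mulrDr mulrCA !mulr_sumr; congr (_ + _); apply: eq_big_nat => c.
  move=> /andP[_ cb]; rewrite IH ?(ltn_trans cb) // !mulr_sumr; apply: eq_big => w.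
    by rewrite /smirnov /= (gtn_eqF cb).
  by move=> _; rewrite des_cons2 cb exprS [\prod_(i <- b :: _) _]big_cons; ring.
move=> /andP[bc cN]; rewrite IH // !mulr_sumr; apply: eq_big => w.
  by rewrite /smirnov /= (ltn_eqF bc).
move=> _; rewrite des_cons2 (leq_gtF (ltnW bc)) add0n.
by rewrite [\prod_(i <- b :: _) _]big_cons; ring.
Qed.

Lemma asc_gf_words (R : comNzRingType) (t : R) y N n :
  asc_gf t y N n =
  \sum_(w <- words N n.+1 | smirnov w && (head 0%N w < last 0%N w)%N)
    t ^+ des w * \prod_(i <- w) y i.
Proof.
rewrite /asc_gf big_words.
(* With the condition b < a moved into the summand the sums can be exchanged; for each word only its
   last letter survives as [a]. *)
transitivity (\sum_(0 <= a < N) \sum_(0 <= b < N)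
    if (b < a)%N then path_gf t y N a n b else 0).
  apply: eq_big_nat => a /andP[_ aN].
  rewrite (@big_cat_nat _ _ _ a _ N) ?(ltnW aN) //= [X in _ = _ + X]big_nat_cond.
  rewrite [X in _ = _ + X]big1 ?addr0.
    by apply: eq_big_nat => b /andP[_ ->].
  by move=> b /andP[/andP[ab _] _]; rewrite ltnNge ab.
rewrite exchange_big; apply: eq_big_nat => b /andP[_ bN] /=.
under eq_bigr => a _ do rewrite (path_gf_words _ _ _ _ bN) big_mkcond /=.
transitivity (\sum_(0 <= a < N) \sum_(w <- words N n)
  if (a == last b w) && (smirnov (b :: w) && (b < last b w)%N) then
   t ^+ des (b :: w) * \prod_(i <- b :: w) y i else 0).
  apply: eq_bigr => a _; case: ifP => ba.
    apply: eq_bigr => w _; rewrite (eq_sym a) andbC.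
    by case: eqP => //= ->; rewrite ba andbT.
  by rewrite big1 // => w _; case: eqP => //= <-; rewrite ba andbF.
rewrite exchange_big [RHS]big_mkcond /= big_seq_cond [RHS]big_seq_cond.
apply: eq_bigr => w; rewrite andbT mem_words => /andP[_ wN].
have lN : (last b w < N)%N.
  by have := mem_last b w; rewrite inE => /orP[/eqP ->//|/(allP wN)].
rewrite (bigD1_seq (last b w)) ?iota_uniq ?mem_index_iota //= eqxx /=.
rewrite [X in _ + X]big1 ?addr0 //.
by move=> a /negbTE ->.
Qed.

(** * Transfer to formal series *)

Notation pseries := {malg int[{cmonom nat}]}.
Definition letter (i : nat) : pseries := << ucm i >>.
Definition pletter (i : nat) : {poly pseries} := (letter i)%:P.

Definition over (N : nat) (m : {cmonom nat}) : Prop :=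
  forall i, i \in finsupp m -> (i < N)%N.

Definition agree (N : nat) (p : pseries) (f : series int) : Prop :=
  forall m, over N m -> p@_m = f m.

Lemma prod_letter w : \prod_(i <- w) letter i = << xmon w >>.
Proof.
rewrite /xmon; elim: w => [|i w IH]; first by rewrite !big_nil.
rewrite !big_cons IH malgM_def fgmulUU mulr1; reflexivity.
Qed.

Lemma exists_over m : exists N, over N m.
Proof.
exists (\max_(i <- finsupp m) i).+1 => i im.
by rewrite ltnS (big_rem i) //= leq_maxl.
Qed.

Lemma agree_elem N k : agree N (elem letter N k) (Defs.esym k).
Proof.
move=> m mN; rewrite elem_words raddf_sum /Defs.esym (word_seriesE _ _ _ mN) /=.
rewrite big_mkcondr; apply: eq_bigr => w _.
by rewrite prod_letter mcoeffU1; case: eqP.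
Qed.

(** Every factor of a monomial over the first N letters is itself over them, so truncation respects
    products. *)
Lemma agree_mul N p q f g :
  agree N p f -> agree N q g -> agree N (p * q) (series_mul f g).
Proof.
move=> pf qg m mN; rewrite /series_mul fsbig_finite; last exact: finite_factors.
have overl (k1 k2 : {cmonom nat}) : mmul k1 k2 = m -> over N k1.
  move=> km i; rewrite -cmE_neq0 => k1i; apply: mN.
  by rewrite -cmE_neq0 -km cmM addn_eq0 negb_and k1i.
pose S := fset_set [set x : {cmonom nat} * {cmonom nat} | mmul x.1 x.2 = m]%classic.
have inS x : (x \in S) = (mmul x.1 x.2 == m).
  by rewrite in_fset_set ?inE //=; [apply/asboolP/eqP | exact: finite_factors].
transitivity (\sum_(x <- S) p@_x.1 * q@_x.2); last first.
  apply: eq_big_seq => x; rewrite inS => /eqP xm.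
  by rewrite pf ?qg //; [exact: overl (etrans (mulmC _ _) xm) | exact: overl xm].
(* The supports are enlarged to contain every factorization of [m], so that both sums run over the
   same pairs. *)
rewrite (@mcoeffMlw _ _ (msupp p `|` [fset x.1 | x in S])%fset
                        (msupp q `|` [fset x.2 | x in S])%fset) ?fsubsetUl //.
set d1 := (_ `|` _)%fset; set d2 := (_ `|` _)%fset.
transitivity (\sum_(x <- [seq (k1, k2) | k1 <- d1, k2 <- d2] | mmul x.1 x.2 == m)
    p@_x.1 * q@_x.2).
  rewrite [in RHS]big_mkcond big_allpairs /=.
  by apply: eq_bigr => k1 _; apply: eq_bigr => k2 _; case: eqP.
rewrite -big_filter; apply: perm_big; apply: uniq_perm; last 1 first.
- move=> x; rewrite mem_filter inS; case: eqP => //= xm.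
  apply/allpairsP; exists x; rewrite -surjective_pairing; split=> //.
    by rewrite inE; apply/orP; right; apply/imfsetP; exists x; rewrite //= inS xm.
  by rewrite inE; apply/orP; right; apply/imfsetP; exists x; rewrite //= inS xm.
- rewrite filter_uniq // allpairs_uniq ?fset_uniq //.
  by move=> [? ?] [? ?] _ _ /= [-> ->].
- exact: fset_uniq.
Qed.

Lemma agree_part N la :
  agree N (\prod_(k <- la) elem letter N k) (esym_part la).
Proof.
elim: la => [|k la IH]; first by rewrite big_nil => m _; rewrite mcoeff1.
by rewrite big_cons; apply: agree_mul => //; apply: agree_elem.
Qed.

(** Commutativity is inherited from the monoid algebra, one monomial at a time. *)
Lemma esym_part_perm la mu : perm_eq la mu -> esym_part la = esym_part mu.
Proof.
move=> lamu; apply: funext => m; have [N mN] := exists_over m.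
by rewrite -!(agree_part _ mN) (perm_big _ lamu).
Qed.

Lemma elem_pletter N k : elem pletter N k = (elem letter N k)%:P.
Proof.
rewrite !elem_words raddf_sum; apply: eq_bigr => w _.
by rewrite /= rmorph_prod.
Qed.

(* The list L does not depend on the number N of variables. *)
Definition epos (f : nat -> {poly pseries}) : Prop :=
  exists L : seq (nat * seq nat),
    all (fun p => 0%N \notin p.2) L /\
    forall N, f N = \sum_(p <- L) 'X^(p.1) * \prod_(k <- p.2) elem pletter N k.

(** * Closure properties of [epos] and the induction on word length *)

Lemma epos_ext f g : f =1 g -> epos g -> epos f.
Proof. by move=> fg [L [L0 gE]]; exists L; split=> // N; rewrite fg. Qed.

Lemma epos0 : epos (fun=> 0).
Proof. by exists [::]; split=> // N; rewrite big_nil. Qed.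

Lemma epos1 : epos (fun=> 1).
Proof. by exists [:: (0%N, [::])]; split=> // N; rewrite big_seq1 big_nil mulr1. Qed.

Lemma eposX : epos (fun=> 'X).
Proof. by exists [:: (1%N, [::])]; split=> // N; rewrite big_seq1 big_nil mulr1. Qed.

Lemma epos_elem k : epos (fun N => elem pletter N k.+1).
Proof. by exists [:: (0%N, [:: k.+1])]; split=> // N; rewrite !big_seq1 mul1r. Qed.

Lemma eposD f g : epos f -> epos g -> epos (fun N => f N + g N).
Proof.
move=> [L [L0 fE]] [M [M0 gE]]; exists (L ++ M); rewrite all_cat L0; split=> // N.
by rewrite big_cat fE gE.
Qed.

Lemma eposM f g : epos f -> epos g -> epos (fun N => f N * g N).
Proof.
move=> [L [L0 fE]] [M [M0 gE]].
exists [seq (p.1 + q.1, p.2 ++ q.2)%N | p <- L, q <- M]; split.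
  apply/allP => _ /allpairsP[[p q] /= [pL qM ->]] /=.
  by rewrite mem_cat negb_or (allP L0 _ pL) (allP M0 _ qM).
move=> N; rewrite big_allpairs_dep fE gE mulr_suml; apply: eq_bigr => p _.
rewrite mulr_sumr; apply: eq_bigr => q _ /=.
by rewrite exprD big_cat mulrACA; reflexivity.
Qed.

Lemma epos_sum n (F : nat -> nat -> {poly pseries}) :
  (forall i, (i < n)%N -> epos (F i)) -> epos (fun N => \sum_(i < n) F i N).
Proof.
elim: n => [|n IH] Fpos.
  by apply: epos_ext epos0 => N; rewrite big_ord0.
apply: (epos_ext (g := fun N => \sum_(i < n) F i N + F n N)).
  by move=> N; rewrite big_ord_recr.
by apply: eposD; [apply: IH => i ni; apply: Fpos; rewrite ltnW | apply: Fpos].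
Qed.

Lemma epos_qint n : epos (fun=> qint 'X n).
Proof.
by elim: n => [|n IH]; [exact: epos0 | apply: eposD epos1 (eposM eposX IH)].
Qed.

Lemma epos_asc_coef n : epos (fun=> asc_coef 'X n).
Proof.
elim: n => [|n IH]; first exact: epos0.
exact: eposD (eposM eposX IH) (epos_qint n).
Qed.

Lemma epos_asc_gf n : epos (fun N => asc_gf 'X pletter N n).
Proof.
elim/ltn_ind: n => n IH.
(* Up to sign this is the monic polynomial ['X - 1]. *)
have reg : GRing.lreg (1 - 'X : {poly pseries}).
  by rewrite -opprB; apply/lregN/monic_lreg; rewrite -polyC1 monicXsubC.
apply: epos_ext (fun N => asc_gf_rec pletter N n reg) _.
apply: eposD; first exact: eposM (epos_asc_coef _) (epos_elem _).
apply: (epos_sum (F := fun i N => 'X * qint 'X i * elem pletter N i.+1 *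
                                  asc_gf 'X pletter N (n - i.+1))) => i ni.
apply: eposM; last by apply: IH; rewrite ltn_subrL (leq_ltn_trans _ ni).
exact: eposM (eposM eposX (epos_qint i)) (epos_elem i).
Qed.

(** * Coefficients of powers of t and their expansion in the e-basis *)

Lemma tcoefE N n A k m : over N m ->
  tcoef k (word_series n A (fun w => 'X^(des w))) m =
  \sum_(w <- words N n | A w && (xmon w == m)) (des w == k)%:R.
Proof.
move=> mN; rewrite /tcoef (word_seriesE _ _ _ mN) coef_sum.
by apply: eq_bigr => w _; rewrite coefXn eq_sym.
Qed.

Lemma tcoef_Wlt N n k m : over N m ->
  tcoef k (Wlt n.+1) m = ((asc_gf 'X pletter N n)`_k)@_m.
Proof.
move=> mN; rewrite (tcoefE _ _ _ mN) asc_gf_words coef_sum raddf_sum /= big_mkcondr.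
apply: eq_bigr => w _; rewrite -rmorph_prod prod_letter coefMC coefXn (eq_sym k).
by rewrite mulr_natl mcoeffMn mcoeffU1; do 2!case: eqP => _.
Qed.

(** Sorting turns each list into a partition without changing its product; the coefficient of a
    partition is then its multiplicity. *)
Lemma e_positive_seq (f : series int) (L : seq (seq nat)) :
  all (fun la => 0%N \notin la) L ->
  (forall m, f m = \sum_(la <- L) esym_part la m) -> e_positive f.
Proof.
move=> L0 fE; pose M := [seq sort geq la | la <- L].
pose c := [fsfun la in [fset la in M]%fset => (count_mem la M)%:R | 0]
  : {fsfun seq nat -> int with 0}.
have cE la : c la = (count_mem la M)%:R.
  rewrite fsfunE inE; case: ifP => // /negbT /count_memPn ->; reflexivity.
have cM la : (la \in finsupp c) = (la \in M).
  by rewrite mem_finsupp cE pnatr_eq0 -lt0n -has_count has_pred1.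
exists c; split=> [la||m].
- rewrite cM => /mapP[mu muL ->]; rewrite /is_partition mem_sort (allP L0 _ muL) andbT.
  by apply: sort_sorted => x y; rewrite /geq /= leq_total.
- by move=> la; rewrite cE ler0n.
rewrite fE; transitivity (\sum_(la <- M) esym_part la m).
  rewrite big_map; apply: eq_bigr => la _; congr (_ m).
  by apply: esym_part_perm; rewrite perm_sym perm_sort.
rewrite -big_undup_iterop_count.
rewrite (perm_big (finsupp c)) /=; last first.
  apply: uniq_perm; rewrite ?undup_uniq ?fset_uniq // => la.
  by rewrite mem_undup cM.
apply: eq_bigr => la _; rewrite cE mulr_natl Monoid.iteropE.
by elim: (count_mem la M) => //= i IH; rewrite mulrS IH.
Qed.

Lemma te_positive_Wlt n : te_positive (Wlt n.+1).
Proof.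
move=> k; have [L [L0 LE]] := epos_asc_gf n.
apply: (@e_positive_seq _ [seq p.2 | p <- L & p.1 == k]) => [|m].
  by rewrite all_map; apply/allP => p; rewrite mem_filter => /andP[_ /(allP L0)].
(* [N] varies with [m], but [L] was fixed beforehand, so one expansion serves all monomials. *)
have [N mN] := exists_over m.
rewrite (tcoef_Wlt _ _ mN) LE coef_sum raddf_sum /= big_map big_filter [RHS]big_mkcond.
apply: eq_bigr => p _; under eq_bigr => i _ do rewrite elem_pletter.
rewrite -rmorph_prod coefMC coefXn eq_sym -(agree_part _ mN) /=.
by case: eqP; rewrite ?mul1r ?mul0r ?mcoeff0.
Qed.

(** * Reversal of words *)

(** The default [a] of [head] makes the comparison false when [s] is empty. *)
Lemma des_cons a s : des (a :: s) = ((head a s < a) + des s)%N.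
Proof.
case: s => [|b s]; last exact: des_cons2.
by rewrite des1 /= ltnn /des eq_card0 // => -[].
Qed.

Lemma des_rcons2 w c b :
  des (rcons (rcons w c) b) = (des (rcons w c) + (b < c))%N.
Proof.
elim: w => [|a w IH]; first by rewrite des_cons2 !des1 addnC.
by rewrite !rcons_cons !des_cons IH addnA; case: w {IH}.
Qed.

(** Adjacent letters differ, so each adjacent pair is a descent in exactly one of the two words. *)
Lemma des_rev w : smirnov w -> (des w + des (rev w))%N = (size w).-1.
Proof.
elim: w => [|b [|c w] IH]; [by rewrite /des !eq_card0 // => -[] | by rewrite !des1 |].
move=> /= /andP[bc cw]; rewrite !rev_cons des_rcons2 des_cons2 -rev_cons.
rewrite addnA -(addnA (c < b)%N) IH //=; move: bc.
by case: ltngtP => //= _ _; rewrite addnC.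
Qed.

Lemma perm_rev_words N n : perm_eq (words N n) [seq rev w | w <- words N n].
Proof.
apply: uniq_perm; first exact: uniq_words.
  by rewrite (map_inj_uniq (can_inj revK)) uniq_words.
move=> w; apply/idP/mapP => [ww|[v vw ->]].
  by exists (rev w); rewrite ?revK // mem_words size_rev all_rev -mem_words.
by rewrite mem_words size_rev all_rev -mem_words.
Qed.

Lemma tcoef_Wgt n k m :
  tcoef k (Wgt n.+1) m = if (k <= n)%N then tcoef (n - k) (Wlt n.+1) m else 0.
Proof.
have [N mN] := exists_over m.
rewrite !(tcoefE _ _ _ mN) (perm_big _ (perm_rev_words N n.+1)) big_map.
(* The subtraction [n - k] is truncated, so [k <= n] stays in the summand to give zero for larger
   [k]. *)
transitivity (\sum_(w <- words N n.+1 |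
    smirnov w && (head 0 w < last 0 w)%N && (xmon w == m))
    ((k <= n)%N && (des w == n - k)%N)%:R : int); last first.
  by case: leqP => //= _; rewrite big1.
rewrite big_seq_cond [RHS]big_seq_cond; apply: eq_big => w.
  rewrite mem_words; congr (_ && (_ && _ && _)).
  - by rewrite /smirnov rev_sorted; apply: eq_sorted => x y /=; rewrite eq_sym.
  - congr (_ < _)%N; first by case: (w) => // a v; rewrite rev_cons last_rcons.
    by case/lastP: (w) => // v a; rewrite rev_rcons last_rcons.
  - by congr (_ == m); apply/eqP/cmP => i; rewrite !xmonE count_rev.
rewrite mem_words; move=> /andP[/andP[/eqP sw _] /andP[/andP[sm _] _]].
have /des_rev : smirnov w.
  move: sm; rewrite /smirnov rev_sorted; congr is_true.
  by apply: eq_sorted => x y /=; rewrite eq_sym.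
rewrite sw /= => E; congr (_%:R); congr nat_of_bool; lia.
Qed.

End Proof.

Theorem corollary2p2 (n : nat) (hn : 1 <= n) :
  te_positive (Wlt n) /\ te_positive (Wgt n).
Proof.
case: n hn => // n _; split=> [|k]; first exact: te_positive_Wlt.
have [kn|nk] := leqP k n.
  have [c [c1 c2 c3]] := te_positive_Wlt n (n - k).
  by exists c; split=> // m; rewrite tcoef_Wgt kn.
(* Beyond degree [n] the coefficient vanishes and is the empty combination. *)
apply: (@e_positive_seq _ [::]) => // m.
by rewrite big_nil tcoef_Wgt leqNgt nk.
Qed.
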